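(* For any positive integers $a$ and $n$, modulo $\Phi_n(q)^2$, $$\left(\!\!\binom{an}{an-n}\!\!\right)_q\equiv\begin{cases}(-1)^m a(1+q^m)q^{m(3m-1)/2}-3m(1-q^{3m})\binom{a}{2},&\text{if } n=3m,\\ (-1)^m a\,q^{m(3m+1)/2}-(3m+1)(1-q^{3m+1})\binom{a}{2},&\text{if } n=3m+1,\\ (-1)^m a\,q^{m(3m-1)/2}-(3m-1)(1-q^{3m-1})\binom{a}{2},&\text{if } n=3m-1,\end{cases}$$ where in each case $m$ is the integer determined by $n$.
   Context: $q$ is an indeterminate. $\Phi_n(q)=\prod_{1\le k\le n,\ \gcd(n,k)=1}(q-\zeta^k)$, with $\zeta$ a primitive $n$-th root of unity, is the $n$-th cyclotomic polynomial. The $q$-shifted factorial is $(a;q)_0=1$, $(a;q)_n=(1-a)(1-aq)\cdots(1-aq^{n-1})$ for $n\ge 1$. The $q$-binomial coefficient is $\begin{bmatrix}n\\k\end{bmatrix}=\frac{(q;q)_n}{(q;q)_k(q;q)_{n-k}}$ if $0\le k\le n$, and $0$ otherwise. For integers $n\ge 0$ and $-n\le j\le n$, the $q$-trinomial coefficient is $$\left(\!\!\binom{n}{j}\!\!\right)_q=\sum_{k=0}^{n}q^{k(k+j)}\begin{bmatrix}n\\k\end{bmatrix}\begin{bmatrix}n-k\\k+j\end{bmatrix}.$$ $\binom{a}{2}$ is the ordinary binomial coefficient. A congruence $A(q)\equiv B(q)$ modulo $\Phi_n(q)^2$ means that $\Phi_n(q)^2$ divides $A(q)-B(q)$ in $\mathbb{Z}[q,q^{-1}]$.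 *)

(* Defs.v *)
From HB Require Import structures.
From mathcomp Require Import all_boot all_order all_algebra all_field.

Set Implicit Arguments.
Unset Strict Implicit.
Unset Printing Implicit Defensive.

Import Order.TTheory GRing.Theory Num.Theory.
Local Open Scope ring_scope.

(* All identities live in the field of fractions of Z[q], which contains
   Z[q, q^-1]; the quotients below are therefore genuine divisions.  In this
   field ^ is exponentiation by an integer and ^+ by a natural number. *)
Notation Qq := {fraction {poly int}}.

Definition q : Qq := tofrac ('X : {poly int}).

Definition qpoch (a x : Qq) (n : nat) : Qq :=
  \prod_(0 <= i < n) (1 - a * x ^+ i).

(* The lower index is an integer because k + j may be negative in qtrinom. *)
Definition qbinom (n : nat) (k : int) : Qq :=
  if (0 <= k) && (k <= n%:Z)
  then qpoch q q n / (qpoch q q `|k|%N * qpoch q q `|n%:Z - k|%N)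
  else 0.

(* Only meaningful for - n <= j <= n. *)
Definition qtrinom (n : nat) (j : int) : Qq :=
  \sum_(0 <= k < n.+1)
    q ^ (k%:Z * (k%:Z + j)) * qbinom n k%:Z * qbinom (n - k) (k%:Z + j).

Definition isLaurent (f : Qq) : Prop :=
  exists (p : {poly int}) (e : nat), f = tofrac p * q ^- e.

(* Membership of A and B is required so that the relation is one between
   elements of Z[q, q^-1], not between arbitrary rational functions. *)
Definition laurent_eqmod (P A B : Qq) : Prop :=
  [/\ isLaurent P, isLaurent A, isLaurent B
    & exists2 C : Qq, isLaurent C & A - B = P * C].

(* Main.v *)
Require Import Defs.
From HB Require Import structures.
From mathcomp Require Import all_boot all_order all_algebra all_field.
From mathcomp Require Import ring zify.

(** The proof has two independent halves.

    Modulo Phi_n^2, the trinomial coefficient reduces to an alternating sum.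
    Write a = b + 1 and w = 1 - q^n, a multiple of Phi_n.  The coefficient
    is the sum over k of q^(k(k+bn)) [an, k] [an-k, k+bn], where only the terms
    with 2k <= n are nonzero.  For 0 < k < n the binomial [an, k] is divisible
    by Phi_n once, because of its factor 1 - q^(an); that factor is a w modulo
    Phi_n^2, so it is enough to know everything else modulo Phi_n, where
    exponents may be reduced modulo n.  Modulo Phi_n^2 this gives
    [an, k] = a [n, k] ([gauss_mul]) and
    [n, k] = w / (1 - q^(n-k)) (-1)^k q^(-binom(k+1, 2))
    ([gauss_alternating]).  The term k = 0 is [an, n], whose expansion to
    second order is a - n w binom(a, 2) ([gauss_mul_n]); this is the
    only source of the correction term in the theorem.  Altogether
    ([trinom_cong]) the coefficient is a S_n - n w binom(a, 2), with
      S_n = sum_k (-1)^k q^(binom(k, 2)) (1-q^n)/(1-q^(n-k)) [n-k, k].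

    The sum S_n has a closed form, as an identity of polynomials: it is a
    finite form of Euler's pentagonal number theorem.  The sum
    U_n(y) = sum_k (-1)^k q^(binom(k, 2)) y^k [n-k, k] satisfies two
    recurrences in (n, y), one for each q-Pascal rule; eliminating y between
    them leaves a recurrence for U_n(1) alone ([altsum_rec4]), which has a
    solution of period 3 up to sign and a power of q ([altsum_closed]), and
    S_n = U_n(1) - q^(n-1) U_(n-2)(1) ([weighted_altsumE]).

    Congruences between fractions are handled in the local ring at Phi_n:
    a denominator is allowed when it does not vanish at a primitive n-th root
    of unity z.  Since Phi_n is monic and is the minimal polynomial of z, a
    Laurent polynomial that is divisible by Phi_n^2 in this local ring is
    divisible by it in Z[q, q^-1] ([local_dvd_poly]).  Everything that the
    congruences use is collected in [cyclotomic_filtration]. *)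

Set Implicit Arguments.
Unset Strict Implicit.
Unset Printing Implicit Defensive.

Import Order.TTheory GRing.Theory Num.Theory.
Local Open Scope ring_scope.

(** * Gaussian binomials over a field *)

(** The pentagonal number m(3m-1)/2, written without division. *)
Definition pent (m : nat) : nat := 'C(m, 2) + m * m.

Lemma pentS m : pent m.+1 = (pent m + (3 * m).+1)%N.
Proof. by rewrite /pent binS bin1; lia. Qed.

(** The base x is kept abstract, which confines the use of Z[q] to the places
    where integrality matters. *)
Section GaussianBinomials.

Variables (F : fieldType) (x : F).
Hypothesis x_nonroot : forall i, 1 - x ^+ i.+1 != 0.

Definition poch (n : nat) : F := \prod_(i < n) (1 - x ^+ i.+1).

Definition gauss (n k : nat) : F :=
  if (k <= n)%N then poch n / (poch k * poch (n - k)) else 0.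

Lemma poch_neq0 n : poch n != 0.
Proof. by apply/prodf_neq0 => i _. Qed.

Lemma pochS n : poch n.+1 = poch n * (1 - x ^+ n.+1).
Proof. by rewrite /poch big_ord_recr. Qed.

Lemma poch0 : poch 0 = 1.
Proof. by rewrite /poch big_ord0. Qed.

Lemma gauss_small n k : (n < k)%N -> gauss n k = 0.
Proof. by rewrite /gauss ltnNge => /negbTE->. Qed.

Lemma gaussDE m k : gauss (m + k) k = poch (m + k) / (poch k * poch m).
Proof. by rewrite /gauss leq_addl addnK. Qed.

Lemma gauss0 n : gauss n 0 = 1.
Proof. by rewrite /gauss subn0 poch0 mul1r divff ?poch_neq0. Qed.

Lemma gaussnn n : gauss n n = 1.
Proof. by rewrite /gauss leqnn subnn poch0 mulr1 divff ?poch_neq0. Qed.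

Lemma gauss_sym n k : (k <= n)%N -> gauss n (n - k) = gauss n k.
Proof.
by move=> le_kn; rewrite /gauss leq_subr le_kn subKn // [poch k * _]mulrC.
Qed.

Lemma gauss_pascal n k :
  gauss n.+1 k.+1 = gauss n k + x ^+ k.+1 * gauss n k.+1.
Proof.
case: (ltngtP n k) => [lt_nk | lt_kn | ->].
- by rewrite !gauss_small ?mulr0 ?addr0 //; lia.
- have [d ->] : exists d, n = (d.+1 + k)%N by exists (n - k.+1)%N; lia.
  rewrite -addnS !gaussDE (addSnnS d k) gaussDE !addnS !pochS !addSn.
  have := poch_neq0 k; have := poch_neq0 d.
  have := x_nonroot k; have := x_nonroot d.
  have -> : x ^+ (d + k).+2 = x ^+ d.+1 * x ^+ k.+1.
    by rewrite -exprD addSn addnS.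
  move: (poch _) (poch _) (poch _) (x ^+ k.+1) (x ^+ d.+1).
  by move=> A B C u v hd hk h1 h2; field; rewrite ?hd ?hk ?h1 ?h2.
- by rewrite !gaussnn gauss_small ?mulr0 ?addr0.
Qed.

(** The other q-Pascal rule is the first one read through the symmetry
    k <-> n - k.  Where the exponent n - k is truncated, it multiplies 0. *)
Lemma gauss_pascal_sym n k :
  gauss n.+1 k.+1 = gauss n k.+1 + x ^+ (n - k) * gauss n k.
Proof.
case: (ltngtP n k) => [lt_nk | lt_kn | ->].
- by rewrite !gauss_small ?mulr0 ?addr0 //; lia.
- have [d defd] : exists d, (n - k = d.+1)%N by exists (n - k).-1; lia.
  rewrite -(@gauss_sym n.+1 k.+1) ?ltnS 1?ltnW // subSS defd gauss_pascal.
  have {1}-> : d = (n - k.+1)%N by lia.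
  by rewrite -defd !gauss_sym // ltnW.
- by rewrite !gaussnn gauss_small // subnn mulr1 add0r.
Qed.

Lemma gauss_absorb n k :
  gauss n.+1 k.+1 = (1 - x ^+ n.+1) / (1 - x ^+ k.+1) * gauss n k.
Proof.
have [lt_nk | le_kn] := ltnP n k; first by rewrite !gauss_small ?mulr0.
rewrite /gauss ltnS le_kn subSS !pochS.
have := poch_neq0 k; have := poch_neq0 (n - k); have := x_nonroot k.
move: (poch _) (poch _) (poch _) => A B C h1 h2 h3.
by field; rewrite ?h1 ?h2 ?h3.
Qed.

Lemma gauss_absorb_sym n k : (k <= n)%N ->
  gauss n.+1 k = (1 - x ^+ n.+1) / (1 - x ^+ (n.+1 - k)) * gauss n k.
Proof.
by move=> le_kn; rewrite -gauss_sym ?leqW // subSn // gauss_absorb gauss_sym.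
Qed.

Lemma gauss_prod N k :
  gauss (N + k) k = \prod_(i < k) ((1 - x ^+ (N + i).+1) / (1 - x ^+ i.+1)).
Proof.
rewrite prodf_div gaussDE.
have -> : poch (N + k) = poch N * \prod_(i < k) (1 - x ^+ (N + i).+1).
  exact: big_split_ord.
by rewrite [poch k * _]mulrC -mulf_div divff ?poch_neq0 // mul1r.
Qed.

Lemma gauss_prod_down n k : (k <= n)%N ->
  gauss n k = \prod_(i < k) ((1 - x ^+ (n - i)) / (1 - x ^+ i.+1)).
Proof.
move=> le_kn; rewrite -{1}(subnK le_kn) gauss_prod !prodf_div; congr (_ / _).
rewrite (reindex_inj rev_ord_inj); apply: eq_bigr => i _ /=.
by congr (1 - x ^+ _); have := ltn_ord i; lia.
Qed.

(** * The finite pentagonal sum *)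

Hypothesis x_neq0 : x != 0.

(** The parameter y is there for the recurrences below, which rescale it; only
    y = 1 has a closed form. *)
Definition altsum (y : F) (n : nat) : F :=
  \sum_(k < n.+1) (-1) ^+ k * x ^+ 'C(k, 2) * y ^+ k * gauss (n - k) k.

Lemma altsum0 y : altsum y 0 = 1.
Proof. by rewrite /altsum big_ord1 gauss0 !expr0 !mulr1. Qed.

Lemma altsum1 y : altsum y 1 = 1.
Proof.
by rewrite /altsum !big_ord_recl big_ord0 gauss0 gauss_small // !expr0 !mulr1
  mulr0 !addr0.
Qed.

(** Peeling off k = 0 and shifting k gives altsum y n.+1 and altsum y n.+2 the
    same shape, up to one unit in the upper index of the Gaussian binomial, so
    that each q-Pascal rule compares them term by term. *)
Lemma altsumS y n :
  altsum y n.+1 =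
  1 - y * \sum_(k < n.+1)
    (-1) ^+ k * x ^+ 'C(k, 2) * (y * x) ^+ k * gauss (n - k) k.+1.
Proof.
rewrite /altsum big_ord_recl /= gauss0 !expr0 !mulr1 mulr_sumr -sumrN.
congr (_ + _); apply: eq_bigr => i _.
rewrite /bump /= add1n subSS binS bin1 exprD !exprS exprMn.
move: (gauss _ _) => G; ring.
Qed.

Lemma altsumSS y n :
  altsum y n.+2 =
  1 - y * \sum_(k < n.+1)
    (-1) ^+ k * x ^+ 'C(k, 2) * (y * x) ^+ k * gauss (n - k).+1 k.+1.
Proof.
rewrite altsumS big_ord_recr /= subnn gauss_small // mulr0 addr0.
by congr (1 - y * _); apply: eq_bigr => i _; rewrite subSn ?leq_ord.
Qed.

Lemma altsum_rec y n :
  altsum y n.+2 = altsum (y * x) n.+1 - y * altsum (y * x) n.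
Proof.
rewrite altsumSS altsumS /altsum.
rewrite -addrA -opprD; congr (1 - _); rewrite -mulrA -mulrDr; congr (y * _).
rewrite mulr_sumr -big_split; apply: eq_bigr => i _ /=.
rewrite gauss_pascal !exprMn exprS.
move: (gauss _ _) (gauss _ _) => G H; ring.
Qed.

Lemma altsum_rec_down y n :
  altsum y n.+2 = altsum y n.+1 - y * x ^+ n * altsum (y / x) n.
Proof.
rewrite altsumSS altsumS /altsum -addrA -opprD; congr (1 - _).
rewrite -mulrA -mulrDr; congr (y * _).
rewrite mulr_sumr -big_split; apply: eq_bigr => i _ /=.
rewrite gauss_pascal_sym.
have [gt | le] := ltnP (n - i) i.
  by rewrite [gauss _ i]gauss_small // !mulr0 !addr0.
have -> : x ^+ n = x ^+ (n - i - i) * x ^+ i * x ^+ i.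
  by rewrite -!exprD; congr (_ ^+ _); lia.
rewrite !exprMn exprVn; have := expf_neq0 i x_neq0.
move: (gauss _ _) (gauss _ _) (x ^+ (_ - _)) (x ^+ i) => G H u v v0.
by field.
Qed.

(** One recurrence leads from y = 1 to y = 1/x, the other leads back. *)
Lemma altsum_rec4 n :
  altsum 1 n.+4 =
  altsum 1 n.+3 - x ^+ n.+2 * altsum 1 n.+1 + x ^+ n.+1 * altsum 1 n.
Proof.
rewrite altsum_rec_down [altsum (1 / x) _]altsum_rec divfK // exprS.
by move: (altsum _ _) (altsum _ _) (altsum _ _) => A B C; field.
Qed.

(** In each residue class modulo 3, the right-hand side of [altsum_rec4] has
    vanishing terms or two terms that cancel, by the recursion [pentS] of the
    pentagonal numbers. *)
Lemma altsum_closed m :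
  [/\ altsum 1 (3 * m) = (-1) ^+ m * x ^+ pent m,
      altsum 1 (3 * m).+1 = (-1) ^+ m * x ^+ (pent m + m)
    & altsum 1 (3 * m).+2 = 0].
Proof.
(* The recurrence of order 4 needs four consecutive values to start. *)
suff [] : [/\ altsum 1 (3 * m) = (-1) ^+ m * x ^+ pent m,
      altsum 1 (3 * m).+1 = (-1) ^+ m * x ^+ (pent m + m),
      altsum 1 (3 * m).+2 = 0
    & altsum 1 (3 * m).+3 = (-1) ^+ m.+1 * x ^+ pent m.+1] by [].
elim: m => [|m [H0 H1 H2 H3]].
  have a2 : altsum 1 2 = 0 by rewrite altsum_rec altsum0 altsum1 mulr1 subrr.
  have a3 : altsum 1 3 = - x.
    by rewrite altsum_rec_down a2 altsum1 mulr1 mul1r expr1 sub0r.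
  by rewrite muln0 a2 a3 altsum0 altsum1 !expr0 !mulr1 expr1 mulN1r.
have -> : (3 * m.+1 = (3 * m).+3)%N by lia.
have E : x ^+ (pent m.+1 + m.+1) = x ^+ (3 * m).+2 * x ^+ (pent m + m).
  by rewrite -exprD pentS; congr (_ ^+ _); lia.
have H4 : altsum 1 (3 * m).+4 = (-1) ^+ m.+1 * x ^+ (pent m.+1 + m.+1).
  rewrite altsum_rec4 H0 H1 H3 E pentS [x ^+ (_ + (3 * m).+1)]exprD exprS.
  by move: (x ^+ _) (x ^+ _) (x ^+ _) => A B C; ring.
have H5 : altsum 1 (3 * m).+1.+4 = 0.
  rewrite altsum_rec4 H1 H2 H4 E [(-1) ^+ m.+1]exprS.
  by move: (x ^+ _) (x ^+ _) (x ^+ _) => A B C; ring.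
split=> //.
rewrite (altsum_rec4 (3 * m).+2) H2 H3 H5 sub0r mulr0 addr0 (pentS m.+1) exprD.
have -> : (3 * m.+1).+1 = (3 * m).+4 by lia.
rewrite [(-1) ^+ m.+2]exprS.
by move: (x ^+ _) (x ^+ _) => A B; ring.
Qed.

Definition weighted_altsum (n : nat) : F :=
  \sum_(k < n.+1) (-1) ^+ k * x ^+ 'C(k, 2) *
    ((1 - x ^+ n) / (1 - x ^+ (n - k))) * gauss (n - k) k.

(** Since 1 - x^n = (1 - x^(n-k)) + x^(n-k) (1 - x^k), the weight splits each
    term into a term of altsum 1 n and, after absorption and a shift of k, a
    term of altsum 1 (n - 2). *)
Lemma weighted_altsumE n :
  weighted_altsum n.+2 = altsum 1 n.+2 - x ^+ n.+1 * altsum 1 n.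
Proof.
rewrite altsumSS /weighted_altsum big_ord_recl /= big_ord_recr /=.
rewrite [bump 0 n.+1]add1n subnn [gauss 0 _]gauss_small // mulr0 addr0.
rewrite gauss0 !expr0 subn0 divff // !mulr1 -addrA; congr (1 + _).
rewrite mul1r -opprD mulr_sumr -big_split -sumrN; apply: eq_bigr => i _ /=.
rewrite /bump /= add1n subSS subSn ?leq_ord // mul1r expr1n mulr1 binS bin1.
rewrite gauss_absorb exprD exprS.
have -> : x ^+ n.+2 = x ^+ (n - i).+1 * x ^+ i.+1.
  by rewrite -exprD; congr (_ ^+ _); have := ltn_ord i; lia.
have -> : x ^+ n.+1 = x ^+ (n - i).+1 * x ^+ i.
  by rewrite -exprD; congr (_ ^+ _); have := ltn_ord i; lia.
have := x_nonroot i; have := x_nonroot (n - i); rewrite exprS.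
move: (gauss _ _) (x ^+ i) (x ^+ (n - i).+1) (x ^+ 'C(i, 2)) ((-1) ^+ i).
by move=> G u v c s h1 h2; field; rewrite h1 h2.
Qed.

Lemma weighted_altsum1 : weighted_altsum 1 = 1.
Proof.
rewrite /weighted_altsum !big_ord_recl big_ord0 gauss0 gauss_small //.
by rewrite !expr0 divff ?mulr1 ?mulr0 ?addr0.
Qed.

Lemma weighted_altsum_3m m : (0 < m)%N ->
  weighted_altsum (3 * m) = (-1) ^+ m * (1 + x ^+ m) * x ^+ pent m.
Proof.
case: m => // m _; have [H0 _ _] := altsum_closed m.+1.
have [_ H1 _] := altsum_closed m; move: H0.
have -> : (3 * m.+1 = (3 * m).+3)%N by lia.
move=> H0; rewrite weighted_altsumE H0 H1.
have E : x ^+ m.+1 * x ^+ pent m.+1 = x ^+ (3 * m).+2 * x ^+ (pent m + m).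
  by rewrite -!exprD pentS; congr (_ ^+ _); lia.
rewrite mulrDr mulr1 mulrDl -[in RHS]mulrA E [(-1) ^+ m.+1]exprS.
by move: (x ^+ _) (x ^+ _) (x ^+ _) => A B C; ring.
Qed.

Lemma weighted_altsum_3mp1 m :
  weighted_altsum (3 * m).+1 = (-1) ^+ m * x ^+ (pent m + m).
Proof.
case: m => [|m]; first by rewrite muln0 weighted_altsum1 !expr0 mulr1.
have [_ H1 _] := altsum_closed m.+1; have [_ _ H2] := altsum_closed m.
move: H1; have -> : (3 * m.+1 = (3 * m).+3)%N by lia.
by move=> H1; rewrite weighted_altsumE H1 H2 mulr0 subr0.
Qed.

Lemma weighted_altsum_3mp2 m :
  weighted_altsum (3 * m).+2 = (-1) ^+ m.+1 * x ^+ pent m.+1.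
Proof.
have [H0 _ H2] := altsum_closed m.
rewrite weighted_altsumE H0 H2 sub0r pentS exprD [(-1) ^+ m.+1]exprS.
by move: (x ^+ _) (x ^+ _) => A B; ring.
Qed.

End GaussianBinomials.

(** * Congruences modulo powers of Phi_n *)

(** D k f stands for: Phi_n^k divides f in the local ring at Phi_n.  These are
    the only properties of Phi_n that the congruences need; in particular D 0
    is the local ring itself, in which 1 - x^i is a unit unless n divides i. *)
Record cyclotomic_filtration (F : fieldType) (x : F) (n : nat)
    (D : nat -> F -> Prop) : Prop := CyclotomicFiltration {
  filt0 : forall k, D k 0;
  filt1 : D 0 1;
  filtN : forall k f, D k f -> D k (- f);
  filtD : forall k f g, D k f -> D k g -> D k (f + g);
  filtM : forall k l f g, D k f -> D l g -> D (k + l) (f * g);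
  filtW : forall k f, D k.+1 f -> D k f;
  filt_x : D 0 x;
  filt_xV : D 0 x^-1;
  filt_n : D 1 (1 - x ^+ n);
  filt_unit : forall i, ~~ (n %| i)%N -> D 0 (1 - x ^+ i)^-1
}.

Section Congruences.

Variables (F : fieldType) (x : F).
Hypothesis x_neq0 : x != 0.
Hypothesis x_nonroot : forall i, 1 - x ^+ i.+1 != 0.
Variables (n : nat) (D : nat -> F -> Prop).
Hypothesis n_gt0 : (0 < n)%N.
Hypothesis Dfilt : cyclotomic_filtration x n D.

Let D0 := filt0 Dfilt.
Let D1 := filt1 Dfilt.
Let DN := filtN Dfilt.
Let DD := filtD Dfilt.
Let DM := filtM Dfilt.
Let DW := filtW Dfilt.
Let Dx := filt_x Dfilt.
Let DxV := filt_xV Dfilt.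
Let Dn := filt_n Dfilt.
Let Dunit := filt_unit Dfilt.

Definition cong (k : nat) (f g : F) : Prop := D k (f - g).

Lemma filtB k f g : D k f -> D k g -> D k (f - g).
Proof. by move=> Df Dg; apply: DD => //; apply: DN. Qed.

Lemma filt_local k f : D k f -> D 0 f.
Proof. by elim: k => // k IHk /DW. Qed.

Lemma filtMl k f g : D 0 f -> D k g -> D k (f * g).
Proof. exact: DM. Qed.

Lemma filtMr k f g : D k f -> D 0 g -> D k (f * g).
Proof. by rewrite mulrC => Df Dg; apply: filtMl. Qed.

Lemma filt_exp f m : D 0 f -> D 0 (f ^+ m).
Proof.
by move=> Df; elim: m => [|m IHm]; rewrite ?expr0 // exprS; apply: filtMl.
Qed.

Lemma filt_nat m : D 0 m%:R.
Proof. by elim: m => [|m IHm]; rewrite ?mulr0n // -addn1 natrD; apply: DD. Qed.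

Lemma filt_sum (I : finType) k (f : I -> F) :
  (forall i, D k (f i)) -> D k (\sum_i f i).
Proof. by move=> Df; apply: big_ind => // *; apply: DD. Qed.

Lemma filt_sub1 i : (i.+1 < n)%N -> D 0 (1 - x ^+ i.+1)^-1.
Proof. by move=> lt_in; apply: Dunit; rewrite gtnNdvd. Qed.

Lemma filt_gauss N k : D 0 (gauss x N k).
Proof.
elim: N k => [|N IHN] [|k]; rewrite ?gauss0 // ?[gauss _ 0 _]gauss_small //.
by rewrite gauss_pascal //; apply/DD/filtMl => //; apply: filt_exp.
Qed.

Lemma cong_refl k f : cong k f f.
Proof. by rewrite /cong subrr. Qed.

Lemma cong_trans k g f h : cong k f g -> cong k g h -> cong k f h.
Proof. by rewrite /cong => fg /(DD fg); rewrite subrKA. Qed.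

Lemma congD k f f' g g' :
  cong k f f' -> cong k g g' -> cong k (f + g) (f' + g').
Proof. by rewrite /cong opprD addrACA; apply: DD. Qed.

Lemma cong_sum (I : finType) k (f g : I -> F) :
  (forall i, cong k (f i) (g i)) -> cong k (\sum_i f i) (\sum_i g i).
Proof. by rewrite /cong -sumrB; apply: filt_sum. Qed.

(** When the first factors are divisible to order l, the second factors only
    have to be known to order k: this is how congruences modulo Phi_n are
    raised to congruences modulo Phi_n^2. *)
Lemma congM l k f f' g g' : D l f' -> D 0 g ->
  cong (l + k) f f' -> cong k g g' -> cong (l + k) (f * g) (f' * g').
Proof.
move=> Df' Dg ff' gg'; rewrite /cong.
have -> : f * g - f' * g' = (f - f') * g + f' * (g - g') by ring.
by apply: DD; [apply: filtMr | apply: DM].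
Qed.

Lemma congMl l k c f g : D l c -> cong k f g -> cong (l + k) (c * f) (c * g).
Proof. by move=> Dc fg; rewrite /cong -mulrBr; apply: DM. Qed.

Lemma cong_local k f g : D 0 g -> cong k f g -> D 0 f.
Proof. by move=> Dg /filt_local /DD /(_ Dg); rewrite subrK. Qed.

Lemma cong_prod (m : nat) (f g : 'I_m -> F) :
  (forall i, D 0 (g i)) -> (forall i, cong 1 (f i) (g i)) ->
  cong 1 (\prod_i f i) (\prod_i g i).
Proof.
elim: m f g => [|m IHm] f g Dg fg; first by rewrite !big_ord0; apply: cong_refl.
rewrite !big_ord_recr /=; apply: (@congM 0) => //.
- by apply: big_ind => // *; apply: filtMl.
- exact: cong_local (fg _).
- exact: IHm.
Qed.

Lemma filt_period b : D 1 (1 - x ^+ (b * n)).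
Proof.
elim: b => [|b IHb]; first by rewrite mul0n expr0 subrr.
have -> : 1 - x ^+ (b.+1 * n) = (1 - x ^+ n) + x ^+ n * (1 - x ^+ (b * n)).
  by rewrite mulSn exprD; ring.
by apply: DD => //; apply: filtMl => //; apply: filt_exp.
Qed.

Lemma cong_period N b : cong 1 (x ^+ (N + b * n)) (x ^+ N).
Proof.
rewrite /cong exprD -[X in _ - X]mulr1 -mulrBr.
apply: filtMl; first exact: filt_exp.
by rewrite -opprB; apply/DN/filt_period.
Qed.

Lemma cong_sub_period N b : cong 1 (1 - x ^+ (N + b * n)) (1 - x ^+ N).
Proof.
rewrite /cong.
have -> : 1 - x ^+ (N + b * n) - (1 - x ^+ N)
    = - (x ^+ (N + b * n) - x ^+ N) by ring.
by apply/DN/cong_period.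
Qed.

(** First-order expansion of 1 - (1 - w)^b for w = 1 - x^n. *)
Lemma cong_period2 b : cong 2 (1 - x ^+ (b * n)) (b%:R * (1 - x ^+ n)).
Proof.
elim: b => [|b IHb]; first by rewrite mul0n expr0 subrr mul0r; apply: cong_refl.
rewrite /cong.
have -> : 1 - x ^+ (b.+1 * n) - b.+1%:R * (1 - x ^+ n) =
  (1 - x ^+ (b * n) - b%:R * (1 - x ^+ n)) - (1 - x ^+ n) * (1 - x ^+ (b * n)).
  by rewrite mulSn exprD -addn1 natrD; ring.
by apply: filtB => //; apply: (@DM 1 1) => //; apply: filt_period.
Qed.

(** As k < n, the product formula has denominators 1 - x^i with 0 < i < n
    only, and its numerators depend on the upper index modulo n. *)
Lemma gauss_period N b k : (k < n)%N -> (k <= N)%N ->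
  cong 1 (gauss x (N + b * n) k) (gauss x N k).
Proof.
move=> lt_kn le_kN; rewrite !gauss_prod_down //;
  last exact: leq_trans (leq_addr _ _).
have lt_in (i : 'I_k) : (i.+1 < n)%N by apply: leq_ltn_trans (ltn_ord i) lt_kn.
apply: cong_prod => i.
  apply: filtMl; last exact: filt_sub1.
  by apply: filtB => //; apply: filt_exp.
rewrite -addnBAC; last by apply: ltnW; apply: leq_trans le_kN.
apply: (@congM 0); first by apply: filtB => //; apply: filt_exp.
- exact: filt_sub1.
- exact: cong_sub_period.
- exact: cong_refl.
Qed.

(** Modulo Phi_n one has x^(n-i) = x^(-i), so that each factor
    (1 - x^(n-i)) / (1 - x^i) of the product formula is - x^(-i). *)
Lemma gauss_pred k : (k < n)%N ->
  cong 1 (gauss x n.-1 k) ((-1) ^+ k * x^-1 ^+ 'C(k.+1, 2)).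
Proof.
move=> lt_kn; rewrite gauss_prod_down //; last by rewrite -ltnS prednK.
have -> j : (-1) ^+ j * x^-1 ^+ 'C(j.+1, 2) = \prod_(i < j) (- x^-1 ^+ i.+1).
  elim: j => [|j IHj]; first by rewrite big_ord0 !expr0 mulr1.
  rewrite big_ord_recr -IHj /= (binS j.+1) bin1 exprD [(-1) ^+ j.+1]exprS.
  by move: ((-1) ^+ j) (x^-1 ^+ 'C(_, _)) (x^-1 ^+ j.+1) => A B C; ring.
apply: cong_prod => i; first by apply/DN/filt_exp.
have lt_in : (i.+1 < n)%N by apply: leq_ltn_trans (ltn_ord i) lt_kn.
rewrite /cong.
have -> : (1 - x ^+ (n.-1 - i)) / (1 - x ^+ i.+1) - - x^-1 ^+ i.+1
   = (1 - x ^+ i.+1)^-1 * x^-1 ^+ i.+1 * (1 - x ^+ n).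
  have -> : x ^+ n = x ^+ (n.-1 - i) * x ^+ i.+1.
    by rewrite -exprD; congr (_ ^+ _); lia.
  rewrite exprVn; have := expf_neq0 i.+1 x_neq0; have := x_nonroot i.
  by move: (x ^+ i.+1) (x ^+ _) => u v h1 h2; field; rewrite h1 h2.
by apply: filtMl => //; apply: filtMl; [apply: filt_sub1 | apply: filt_exp].
Qed.

(** The quotient is 1 + x^n + ... + x^(bn), and x^(jn) = 1 - j w modulo w^2 for
    w = 1 - x^n. *)
Lemma cong_geometric b :
  cong 2 ((1 - x ^+ (b.+1 * n)) / (1 - x ^+ n))
    (b.+1%:R - 'C(b.+1, 2)%:R * (1 - x ^+ n)).
Proof.
have w0 : 1 - x ^+ n != 0 by rewrite -(prednK n_gt0).
elim: b => [|b IHb].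
  by rewrite mul1n divff // mul0r subr0; apply: cong_refl.
rewrite /cong.
have -> : (1 - x ^+ (b.+2 * n)) / (1 - x ^+ n) -
    (b.+2%:R - 'C(b.+2, 2)%:R * (1 - x ^+ n)) =
  ((1 - x ^+ (b.+1 * n)) / (1 - x ^+ n) -
    (b.+1%:R - 'C(b.+1, 2)%:R * (1 - x ^+ n)))
  - (1 - x ^+ (b.+1 * n) - b.+1%:R * (1 - x ^+ n)).
  rewrite mulSn exprD binS bin1 natrD -[b.+2]addn1 natrD.
  move: (x ^+ (_ * n)) (x ^+ n) w0 => y z w0.
  by field.
by apply: filtB => //; apply: cong_period2.
Qed.

Lemma cong_prod1D (e : F) (f : nat -> F) m :
  D 1 e -> (forall i, (i < m)%N -> D 0 (f i)) ->
  cong 2 (\prod_(i < m) (1 + e * f i)) (1 + e * \sum_(i < m) f i).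
Proof.
move=> De; elim: m => [|m IHm] Df.
  by rewrite !big_ord0 mulr0 addr0; apply: cong_refl.
have {}IHm := IHm (fun i lt_im => Df i (leqW lt_im)).
have DS : D 0 (\sum_(i < m) f i) by apply: filt_sum => i; apply/Df/leqW.
have Dfm := Df m (leqnn _).
rewrite !big_ord_recr /= /cong.
move: (\prod_(_ < _) _) (\sum_(_ < _) _) IHm DS => P S IHm DS.
have -> : P * (1 + e * f m) - (1 + e * (S + f m)) =
    (P - (1 + e * S)) * (1 + e * f m) + (e * e) * (S * f m) by ring.
apply: DD; apply: filtMr => //.
- by apply: DD => //; apply: filtMl => //; apply: filt_local De.
- exact: (@DM 1 1).
- exact: filtMl.
Qed.

(** The terms of index i and n - i add up to -1 modulo Phi_n, where
    x^i x^(n-i) = 1.  The factor 2 avoids having to invert it. *)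
Lemma cong_half_sum :
  cong 1 (2 * \sum_(i < n.-1) x ^+ i.+1 / (1 - x ^+ i.+1)) (- n.-1%:R).
Proof.
have -> : - n.-1%:R = \sum_(i < n.-1) (-1) :> F.
  by rewrite sumr_const card_ord mulNrn.
rewrite mulr_natl mulr2n {2}(reindex_inj rev_ord_inj) -big_split.
apply: cong_sum => i /=; have lt_i := ltn_ord i; rewrite /cong.
have -> : x ^+ i.+1 / (1 - x ^+ i.+1)
    + x ^+ (n.-1 - i.+1).+1 / (1 - x ^+ (n.-1 - i.+1).+1) - (-1)
   = (1 - x ^+ i.+1)^-1 * (1 - x ^+ (n.-1 - i.+1).+1)^-1 * (1 - x ^+ n).
  have -> : x ^+ n = x ^+ i.+1 * x ^+ (n.-1 - i.+1).+1.
    by rewrite -exprD; congr (_ ^+ _); lia.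
  have := x_nonroot i; have := x_nonroot (n.-1 - i.+1).
  by move: (x ^+ i.+1) (x ^+ _) => u v h1 h2; field; rewrite h1 h2.
by apply: filtMl => //; apply: filtMl; apply: filt_sub1; lia.
Qed.

(** In the product formula the last factor is a geometric sum, expanded by
    [cong_geometric]; the others are 1 + e x^i / (1 - x^i) with
    e = 1 - x^(bn), so that to second order their product only involves the
    sum evaluated by [cong_half_sum]. *)
Lemma gauss_mul_n b :
  cong 2 (gauss x (b * n + n) n)
    (b.+1%:R - n%:R * (1 - x ^+ n) * 'C(b.+1, 2)%:R).
Proof.
have prod_last (G : nat -> F) :
    \prod_(i < n) G i = \prod_(i < n.-1) G i * G n.-1.
  by case: n n_gt0 => // m _; rewrite big_ord_recr.
rewrite gauss_prod //.
have /= -> := prod_last (fun i => (1 - x ^+ (b * n + i).+1) / (1 - x ^+ i.+1)).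
rewrite -addnS prednK // -mulSnr.
pose e := 1 - x ^+ (b * n); pose f i := x ^+ i.+1 / (1 - x ^+ i.+1).
have De : D 1 e by exact: filt_period.
have Df i : (i < n.-1)%N -> D 0 (f i).
  by move=> ?; apply: filtMl; [apply: filt_exp | apply: filt_sub1; lia].
have -> : \prod_(i < n.-1) ((1 - x ^+ (b * n + i).+1) / (1 - x ^+ i.+1))
    = \prod_(i < n.-1) (1 + e * f i).
  apply: eq_bigr => i _; rewrite /e /f -addnS exprD; have := x_nonroot i.
  by move: (x ^+ i.+1) (x ^+ _) => u v h; field.
pose S := \sum_(i < n.-1) f i.
have DS : D 0 S by apply: filt_sum => i; apply: Df.
have Dw := Dn; have := cong_period2 b; rewrite -/e.
have := cong_half_sum; rewrite -/S.
have := cong_geometric b; set A := _ / _ => cA.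
have Cb : 'C(b.+1, 2)%:R * 2 = b.+1%:R * b%:R :> F.
  rewrite -!natrM; congr _%:R.
  by elim: (b) => // c IHc; rewrite binS bin1 mulnDl IHc; lia.
have En : n%:R = n.-1%:R + 1 :> F by rewrite natr1 prednK.
move: (\prod_(_ < _) _) (cong_prod1D De Df) => P; rewrite -/S => cP.
move=> c2S ce; apply: (cong_trans (congM (l := 0) _ _ cP cA)).
  by apply: DD => //; apply: filtMr DS; apply: filt_local De.
  apply: cong_local cA; apply: filtB; first exact: filt_nat.
  by apply: filtMl; [apply: filt_nat | apply: filt_local Dw].
move: (1 - x ^+ n) Dw ce => w Dw ce.
(* The term w S has coefficient b(b+1) = 2 binom(b+1, 2), and 2 S = - (n-1);
   all other terms of the difference are of order 2. *)
rewrite En /cong.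
have -> : (1 + e * S) * (b.+1%:R - 'C(b.+1, 2)%:R * w)
      - (b.+1%:R - (n.-1%:R + 1) * w * 'C(b.+1, 2)%:R) =
    (e - b%:R * w) * (b.+1%:R * S)
    + w * (2 * S - (- n.-1%:R)) * 'C(b.+1, 2)%:R
    - w * e * ('C(b.+1, 2)%:R * S)
    + (b.+1%:R * b%:R - 'C(b.+1, 2)%:R * 2) * (w * S) by ring.
rewrite Cb subrr mul0r addr0; apply: filtB; first apply: DD.
- by apply: filtMr => //; apply: filtMl => //; apply: filt_nat.
- by apply: filtMr (filt_nat _); apply: (@DM 1 1).
- by apply: filtMr; [apply: (@DM 1 1) | apply: filtMl => //; apply: filt_nat].
Qed.

(** Absorption extracts 1 - x^((b+1)n), which is (b+1)(1 - x^n) modulo Phi_n^2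
    and already accounts for one factor Phi_n; the remaining factor is periodic
    modulo Phi_n. *)
Lemma gauss_mul b k : (0 < k < n)%N ->
  cong 2 (gauss x (n + b * n) k) (b.+1%:R * gauss x n k).
Proof.
case/andP=> k_gt0 lt_kn; rewrite -(prednK k_gt0) -{1 3}(prednK n_gt0) addSn.
rewrite !gauss_absorb // -addSn prednK // -mulSn mulrA mulrA.
apply: (@congM 1 1).
- by apply: filtMr; [apply: filtMl => //; apply: filt_nat
    | apply: filt_sub1; rewrite prednK].
- exact: filt_gauss.
- apply: (@congM 0); last exact: cong_refl.
  + by apply: filtMl; [apply: filt_nat | apply: filt_local Dn].
  + by apply: filt_sub1; rewrite prednK.
  + exact: cong_period2.
- by apply: gauss_period; lia.
Qed.

Lemma gauss_alternating k : (0 < k < n)%N ->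
  cong 2 (gauss x n k)
    ((1 - x ^+ n) / (1 - x ^+ (n - k)) * ((-1) ^+ k * x^-1 ^+ 'C(k.+1, 2))).
Proof.
case/andP=> k_gt0 lt_kn.
have -> : gauss x n k = (1 - x ^+ n) / (1 - x ^+ (n - k)) * gauss x n.-1 k.
  by rewrite -{1 2 3}(prednK n_gt0) gauss_absorb_sym // -ltnS prednK.
apply: (@congMl 1 1); last exact: gauss_pred.
by apply: filtMr => //; apply: Dunit; rewrite gtnNdvd //; lia.
Qed.

Definition trinom (N j : nat) : F :=
  \sum_(k < N.+1) x ^+ (k * (k + j)) * gauss x N k * gauss x (N - k) (k + j).

Lemma trinom_short b : trinom (n + b * n) (b * n) =
  \sum_(k < n.+1) x ^+ (k * (k + b * n)) * gauss x (n + b * n) k *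
     gauss x (n + b * n - k) (k + b * n).
Proof.
rewrite /trinom -addSn big_split_ord /= [X in _ + X]big1 ?addr0 // => i _.
by rewrite [gauss _ (_ - _) _]gauss_small ?mulr0 //; lia.
Qed.

(** The factor [n + bn, k] is divisible by Phi_n, hence the other two factors
    may be replaced by x^(k^2) and [n-k, k], which they equal modulo Phi_n.
    The exponents combine through k^2 = binom(k, 2) + binom(k+1, 2). *)
Lemma trinom_term b k : (0 < k <= n)%N ->
  cong 2 (x ^+ (k * (k + b * n)) * gauss x (n + b * n) k *
            gauss x (n + b * n - k) (k + b * n))
    (b.+1%:R * ((-1) ^+ k * x ^+ 'C(k, 2) *
      ((1 - x ^+ n) / (1 - x ^+ (n - k))) * gauss x (n - k) k)).
Proof.
case/andP=> k_gt0 le_kn.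
have [lt_n2k | le_2kn] := ltnP n (k + k).
  rewrite [gauss _ (_ + _ - _) _]gauss_small; last by lia.
  by rewrite [gauss _ (n - k) _]gauss_small ?mulr0; [apply: cong_refl | lia].
have k_bounds : (0 < k < n)%N by lia.
(* Periodicity applies to a lower index less than n, which the symmetry
   provides: n - 2k instead of k + bn. *)
have sym1 : gauss x (n + b * n - k) (k + b * n)
    = gauss x (n - k + b * n) (n - k - k).
  by rewrite -gauss_sym; [congr (gauss x _ _) |]; lia.
have c3 : cong 1 (gauss x (n + b * n - k) (k + b * n)) (gauss x (n - k) k).
  by rewrite sym1 -[gauss x (n - k) k]gauss_sym; [apply: gauss_period|]; lia.
have c1 : cong 1 (x ^+ (k * (k + b * n))) (x ^+ (k * k)).
  by rewrite mulnDr mulnA; apply: cong_period.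
have c2 := gauss_mul b k_bounds; have c4 := gauss_alternating k_bounds.
have Dk : D 0 (1 - x ^+ (n - k))^-1 by apply: Dunit; rewrite gtnNdvd //; lia.
set W := (1 - x ^+ n) / (1 - x ^+ (n - k)) in c4 *.
set alpha := (-1) ^+ k * _ in c4.
have DW1 : D 1 W by apply: filtMr.
have Dalpha : D 0 alpha.
  by apply: filtMl; apply: filt_exp => //; apply: DN.
have c5 : cong 2 (gauss x (n + b * n) k) (b.+1%:R * (W * alpha)).
  by apply: cong_trans c2 _; apply: (@congMl 0); first exact: filt_nat.
have Dc5 : D 1 (b.+1%:R * (W * alpha)).
  by apply: filtMl; [apply: filt_nat | apply: filtMr].
have -> : b.+1%:R * ((-1) ^+ k * x ^+ 'C(k, 2) * W * gauss x (n - k) k)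
    = b.+1%:R * (W * alpha) * x ^+ (k * k) * gauss x (n - k) k.
  have -> : x ^+ 'C(k, 2) = x ^+ (k * k) * x^-1 ^+ 'C(k.+1, 2).
    have -> : (k * k = 'C(k, 2) + 'C(k.+1, 2))%N.
      elim: (k) => // j; have := binS j 1; have := binS j.+1 1; rewrite !bin1.
      lia.
    by rewrite exprD exprVn mulfK ?expf_neq0.
  by rewrite /alpha; move: (gauss _ _ _) (_ ^+ _) (_ ^+ _) (_ ^+ _) => *; ring.
rewrite [x ^+ _ * gauss _ _ _]mulrC.
apply: (@congM 1 1) => //; first by apply: filtMr => //; apply: filt_exp.
  exact: filt_gauss.
by apply: (@congM 1 1) => //; apply: filt_exp.
Qed.

(** The term k = 0 carries the second-order correction; each of the others is
    b + 1 times the corresponding term of the pentagonal sum. *)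
Lemma trinom_cong b :
  cong 2 (trinom (n + b * n) (b * n))
    (b.+1%:R * weighted_altsum x n
      - n%:R * (1 - x ^+ n) * 'C(b.+1, 2)%:R).
Proof.
rewrite trinom_short big_ord_recl /= /weighted_altsum big_ord_recl /=.
rewrite !subn0 !gauss0 // !expr0 add0n !mulr1 !mul1r.
have -> : gauss x (n + b * n) (b * n) = gauss x (b * n + n) n.
  by rewrite -[RHS]gauss_sym ?leq_addl // addnK addnC.
rewrite divff; last by rewrite -(prednK n_gt0).
rewrite [b.+1%:R * _]mulrDr mulr1.
rewrite [X in cong _ _ X]addrAC; apply: congD; first exact: gauss_mul_n.
rewrite mulr_sumr; apply: cong_sum => i.
by apply: trinom_term; rewrite /bump /= add1n ltn_ord.
Qed.

End Congruences.

(** * The local ring at Phi_n *)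

Lemma q_neq0 : q != 0.
Proof. by rewrite tofrac_eq0 polyX_eq0. Qed.

Lemma q_exp i : q ^+ i = tofrac 'X^i.
Proof. by rewrite tofracXn. Qed.

Lemma one_sub_qX i : 1 - q ^+ i = tofrac (1 - 'X^i).
Proof. by rewrite q_exp -tofrac1 -tofracB. Qed.

Lemma q_nonroot i : 1 - q ^+ i.+1 != 0.
Proof.
rewrite one_sub_qX tofrac_eq0 -opprB oppr_eq0.
by rewrite -size_poly_eq0 size_XnsubC.
Qed.

Lemma qbinomE n k : qbinom n k%:Z = gauss q n k.
Proof.
rewrite /qbinom /gauss lez_nat.
case: (leqP k n) => // le_kn; rewrite /= subzn // !absz_nat.
have E m : qpoch q q m = poch q m.
  by rewrite /qpoch big_mkord; apply: eq_bigr => i _; rewrite exprS.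
by rewrite !E.
Qed.

Lemma qtrinomE n b :
  qtrinom (b.+1 * n) ((b.+1 * n)%:Z - n%:Z) = trinom q (n + b * n) (b * n).
Proof.
have -> : (b.+1 * n)%:Z - n%:Z = (b * n)%:Z by rewrite mulSn PoszD addrC addKr.
rewrite /qtrinom big_mkord mulSn; apply: eq_bigr => i _.
by rewrite -PoszD -PoszM !qbinomE.
Qed.

Definition eval (z : algC) (p : {poly int}) : algC := (map_poly intr p).[z].

Lemma evalD z p r : eval z (p + r) = eval z p + eval z r.
Proof. by rewrite /eval rmorphD hornerD. Qed.

Lemma evalM z p r : eval z (p * r) = eval z p * eval z r.
Proof. by rewrite /eval rmorphM hornerM. Qed.

Lemma eval1 z : eval z 1 = 1.
Proof. by rewrite /eval rmorph1 hornerC. Qed.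

Lemma evalX z : eval z 'X = z.
Proof. by rewrite /eval map_polyX hornerX. Qed.

Lemma eval_1subX z i : eval z (1 - 'X^i) = 1 - z ^+ i.
Proof.
rewrite /eval rmorphB /= rmorph1 map_polyXn.
by rewrite hornerD hornerN hornerXn hornerC.
Qed.

Lemma eval_Phi n z : n.-primitive_root z -> eval z 'Phi_n = 0.
Proof.
move=> prim_z; rewrite /eval (Cintr_Cyclotomic prim_z).
by apply/eqP; rewrite -[_ == 0]/(root _ _) root_cyclotomic.
Qed.

(** The remainder of p modulo the monic Phi_n still vanishes at z, but its
    degree is less than that of the minimal polynomial of z, so it is 0. *)
Lemma Phi_dvd_of_root n z (p : {poly int}) :
  n.-primitive_root z -> eval z p = 0 -> exists r, p = 'Phi_n * r.
Proof.
move=> prim_z pz0; have monPhi := Cyclotomic_monic n.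
have Dp := Pdiv.RingMonic.rdivp_eq monPhi p.
have lt_r := Pdiv.Ring.ltn_rmodpN0 p (monic_neq0 monPhi).
move: (Pdiv.Ring.rmodp _ _) (Pdiv.Ring.rdivp _ _) Dp lt_r => r s Dp lt_r.
suff r0 : r = 0 by exists s; rewrite Dp r0 addr0 mulrC.
move: pz0; rewrite Dp evalD evalM eval_Phi // mulr0 add0r => rz0.
apply: contraTeq lt_r => r_neq0; rewrite -leqNgt.
have [m [Dm _] dvd_m] := minCpolyP z.
pose rQ : {poly rat} := map_poly intr r.
have sz_rQ : size rQ = size r.
  by apply: size_map_inj_poly => //; apply: intr_inj.
have : m %| rQ.
  rewrite -dvd_m /root /rQ -map_poly_comp; apply/eqP; rewrite -[RHS]rz0 /eval.
  by congr (_.[z]); apply: eq_map_poly => c /=; rewrite rmorph_int.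
move/dvdp_leq; rewrite -size_poly_eq0 sz_rQ size_poly_eq0 => /(_ r_neq0).
rewrite size_Cyclotomic -(size_cyclotomic z) -(minCpoly_cyclotomic prim_z) Dm.
by rewrite size_map_poly.
Qed.

(** z is meant to be a primitive n-th root of unity: d is then a unit of the
    local ring at Phi_n exactly when it does not vanish at z. *)
Definition local_dvd (z : algC) (n k : nat) (f : Qq) : Prop :=
  exists p d, eval z d != 0 /\ f * tofrac d = tofrac ('Phi_n ^+ k * p).

(** Each factor Phi_n can be split off p in turn: the denominator d does not
    vanish at z, hence p does. *)
Lemma local_dvd_poly n z k (p : {poly int}) : n.-primitive_root z ->
  local_dvd z n k (tofrac p) -> exists r, p = 'Phi_n ^+ k * r.
Proof.
move=> prim_z [s [d [dz]]]; rewrite -tofracM => /eqP; rewrite tofrac_eq => /eqP.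
elim: k p => [|k IHk] p Dp; first by exists p; rewrite mul1r.
have [|p' Dp'] := @Phi_dvd_of_root n z p prim_z.
  apply/eqP; rewrite -(mulIr_eq0 _ (mulIf dz)) -evalM Dp exprS !evalM.
  by rewrite eval_Phi // !mul0r.
have [|r Dr] := IHk p'; last by exists r; rewrite Dp' Dr exprS mulrA.
apply: (mulfI (monic_neq0 (Cyclotomic_monic n))).
by rewrite mulrA -Dp' Dp exprS mulrA.
Qed.

Lemma local_dvd_filtration n z : n.-primitive_root z ->
  cyclotomic_filtration q n (local_dvd z n).
Proof.
move=> prim_z; have n_gt0 := prim_order_gt0 prim_z.
have e1 : eval z 1 != 0 by rewrite eval1 oner_neq0.
split=> [k||k f|k f g|k l f g|k f||||i].
- by exists 0, 1; rewrite mul0r mulr0 tofrac0.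
- by exists 1, 1; rewrite expr0 !mul1r tofrac1.
- by case=> p [d [dz E]]; exists (- p), d; rewrite mulNr E mulrN tofracN.
- case=> p [d [dz E]] [r [e [ez E']]]; exists (p * e + r * d), (d * e).
  rewrite evalM mulf_neq0 //; split=> //.
  rewrite mulrDr !mulrA tofracD !tofracM -!tofracM.
  by rewrite [tofrac (_ * _ * e)]tofracM [tofrac (_ * _ * d)]tofracM -E -E'
    tofracM mulrDl mulrA -!mulrA [tofrac e * tofrac d]mulrC.
- case=> p [d [dz E]] [r [e [ez E']]]; exists (p * r), (d * e).
  rewrite evalM mulf_neq0 //; split=> //.
  by rewrite tofracM mulrACA E E' -tofracM exprD mulrACA.
- case=> p [d [dz E]]; exists ('Phi_n * p), d; split=> //.
  by rewrite E exprSr mulrA.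
- by exists 'X, 1; rewrite expr0 mul1r tofrac1 mulr1.
- exists 1, 'X; rewrite evalX expr0 mul1r mulVf ?q_neq0 ?tofrac1 //.
  split=> //; apply: contraTneq prim_z => ->; apply/negP => prim0.
  have /eqP := prim_expr_order prim0.
  by rewrite expr0n -(prednK n_gt0) /= eq_sym oner_eq0.
- exists (- \prod_(d <- rem n (divisors n)) 'Phi_d), 1; split=> //.
  rewrite one_sub_qX tofrac1 mulr1 expr1 mulrN -opprB -prod_Cyclotomic //.
  by rewrite (big_rem n) // -dvdn_divisors.
- move=> not_dvd; exists 1, (1 - 'X^i); rewrite eval_1subX; split.
    by rewrite subr_eq0 eq_sym -(prim_order_dvd prim_z).
  rewrite expr0 mulr1 tofrac1 -one_sub_qX mulVf //.
  by case: i not_dvd => [|i]; rewrite ?dvdn0 // => _; apply: q_nonroot.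
Qed.

(** * Laurent polynomials *)

Lemma laurent_poly p : isLaurent (tofrac p).
Proof. by exists p, 0%N; rewrite expr0 invr1 mulr1. Qed.

Lemma laurentM f g : isLaurent f -> isLaurent g -> isLaurent (f * g).
Proof.
move=> [p [e ->]] [r [d ->]]; exists (p * r), (e + d)%N.
by rewrite tofracM mulrACA -invfM -exprD.
Qed.

Lemma laurentD f g : isLaurent f -> isLaurent g -> isLaurent (f + g).
Proof.
move=> [p [e ->]] [r [d ->]]; exists (p * 'X^d + r * 'X^e), (e + d)%N.
by rewrite addf_div ?expf_neq0 ?q_neq0 // tofracD !tofracM -!q_exp exprD.
Qed.

Lemma laurentN f : isLaurent f -> isLaurent (- f).
Proof. by case=> [p [e ->]]; exists (- p), e; rewrite tofracN mulNr. Qed.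

Lemma laurent_q i : isLaurent (q ^+ i).
Proof. by rewrite q_exp; apply: laurent_poly. Qed.

Lemma laurent1 : isLaurent 1.
Proof. by rewrite -tofrac1; apply: laurent_poly. Qed.

Lemma laurent_nat i : isLaurent i%:R.
Proof.
elim: i => [|i IHi]; first by rewrite mulr0n -tofrac0; apply: laurent_poly.
by rewrite -natr1; apply: laurentD laurent1.
Qed.

Lemma laurent_sign i : isLaurent ((-1) ^+ i).
Proof.
elim: i => [|i IHi]; first by rewrite expr0; apply: laurent1.
by rewrite exprS; apply: laurentM IHi; apply/laurentN/laurent1.
Qed.

(** Integrality is invisible on the quotient of q-factorials; it comes from the
    q-Pascal rule. *)
Lemma laurent_gauss N k : isLaurent (gauss q N k).
Proof.
have nonroot := q_nonroot.
elim: N k => [|N IHN] [|k]; rewrite ?gauss0 ?[gauss _ 0 _]gauss_small //;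
  try exact: (laurent_nat 0); try exact: laurent1.
rewrite gauss_pascal //; apply: laurentD => //.
by apply: laurentM => //; apply: laurent_q.
Qed.

Lemma laurent_trinom N j : isLaurent (trinom q N j).
Proof.
apply: big_ind => [|f g|i _]; [exact: (laurent_nat 0) | exact: laurentD |].
by apply/laurentM/laurent_gauss/laurentM/laurent_gauss/laurent_q.
Qed.

(** A power of q clears the denominators of f - g and is a unit of the local
    ring, which reduces the claim to [local_dvd_poly]. *)
Lemma laurent_eqmod_of_local n k z f g : n.-primitive_root z ->
  isLaurent f -> isLaurent g -> local_dvd z n k (f - g) ->
  laurent_eqmod (tofrac 'Phi_n ^+ k) f g.
Proof.
move=> prim_z Lf Lg fg; have filt := local_dvd_filtration prim_z.
split=> //; first by rewrite -tofracXn; apply: laurent_poly.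
have [p [e fgE]] := laurentD Lf (laurentN Lg).
have qe0 := expf_neq0 e q_neq0.
have [|r Dr] := @local_dvd_poly n z k p prim_z.
  have -> : tofrac p = (f - g) * q ^+ e by rewrite fgE divfK.
  by apply: (filtMr filt) => //; apply: (filt_exp filt); apply: (filt_x filt).
exists (tofrac r * q ^- e); first by exists r, e.
by rewrite fgE Dr tofracM tofracXn mulrA.
Qed.

Lemma qtrinom_eqmod (a n : nat) (w : Qq) :
  (0 < a)%N -> (0 < n)%N -> weighted_altsum q n = w -> isLaurent w ->
  laurent_eqmod (tofrac 'Phi_n ^+ 2) (qtrinom (a * n) ((a * n)%:Z - n%:Z))
    (a%:R * w - n%:R * (1 - q ^+ n) * 'C(a, 2)%:R).
Proof.
case: a => // b _ n_gt0 <- Lw; have [z prim_z] := C_prim_root_exists n_gt0.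
rewrite qtrinomE; apply: (laurent_eqmod_of_local prim_z).
- exact: laurent_trinom.
- apply: laurentD; first by apply: laurentM => //; apply: laurent_nat.
  apply/laurentN/laurentM; last exact: laurent_nat.
  apply: laurentM; first exact: laurent_nat.
  by apply: laurentD laurent1 _; apply/laurentN/laurent_q.
- exact: (trinom_cong q_neq0 q_nonroot n_gt0 (local_dvd_filtration prim_z)).
Qed.

(** * The theorem *)

Lemma pentE (m : nat) : (m%:Z * (3 * m%:Z - 1) %/ 2)%Z = (pent m)%:Z.
Proof.
have -> : m%:Z * (3 * m%:Z - 1) = (pent m)%:Z * 2.
  elim: m => // m IHm; rewrite pentS; lia.
by rewrite mulzK.
Qed.

Lemma pentDE (m : nat) : (m%:Z * (3 * m%:Z + 1) %/ 2)%Z = (pent m + m)%:Z.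
Proof.
have -> : m%:Z * (3 * m%:Z + 1) = m%:Z * (3 * m%:Z - 1) + m%:Z * 2 by ring.
by rewrite divzDr ?dvdz_mull // mulzK // pentE.
Qed.

Theorem theorem1p2 (a n : nat) (m : int) (a_gt0 : (0 < a)%N) (n_gt0 : (0 < n)%N) :
  let T := qtrinom (a * n) ((a * n)%:Z - n%:Z) in
  let P := tofrac 'Phi_n ^+ 2 in
  [/\ n%:Z = 3 * m ->
        laurent_eqmod P T
          ((-1) ^ m * a%:R * (1 + q ^ m) * q ^ (m * (3 * m - 1) %/ 2)%Z
           - (3 * m)%:~R * (1 - q ^ (3 * m)) * 'C(a, 2)%:R),
      n%:Z = 3 * m + 1 ->
        laurent_eqmod P T
          ((-1) ^ m * a%:R * q ^ (m * (3 * m + 1) %/ 2)%Z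
           - (3 * m + 1)%:~R * (1 - q ^ (3 * m + 1)) * 'C(a, 2)%:R)
    & n%:Z = 3 * m - 1 ->
        laurent_eqmod P T
          ((-1) ^ m * a%:R * q ^ (m * (3 * m - 1) %/ 2)%Z
           - (3 * m - 1)%:~R * (1 - q ^ (3 * m - 1)) * 'C(a, 2)%:R)].
Proof.
move=> T P.
have main w := @qtrinom_eqmod a n w a_gt0 n_gt0.
split=> Dn.
- have [k Dm] : exists k, m = k%:Z by exists `|m|%N; lia.
  move: Dn; rewrite {m}Dm pentE => Dn; rewrite -Dn.
  have nE : n = (3 * k)%N by lia.
  have W : weighted_altsum q n = (-1) ^+ k * (1 + q ^+ k) * q ^+ pent k.
    by rewrite nE (weighted_altsum_3m q_nonroot q_neq0) //; lia.
  have := main _ W; rewrite mulrA mulrA [a%:R * _]mulrC; apply.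
  apply/laurentM/laurent_q/laurentM; first exact: laurent_sign.
  by apply: laurentD laurent1 _; apply: laurent_q.
- have [k Dm] : exists k, m = k%:Z by exists `|m|%N; lia.
  move: Dn; rewrite {m}Dm pentDE => Dn; rewrite -Dn.
  have nE : n = (3 * k).+1 by lia.
  have W : weighted_altsum q n = (-1) ^+ k * q ^+ (pent k + k).
    by rewrite nE (weighted_altsum_3mp1 q_nonroot q_neq0).
  have := main _ W; rewrite mulrA [a%:R * _]mulrC; apply.
  by apply: laurentM; [apply: laurent_sign | apply: laurent_q].
- have [k Dm] : exists k, m = k.+1%:Z by exists `|m - 1|%N; lia.
  move: Dn; rewrite {m}Dm pentE => Dn; rewrite -Dn.
  have nE : n = (3 * k).+2 by lia.
  have W : weighted_altsum q n = (-1) ^+ k.+1 * q ^+ pent k.+1.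
    by rewrite nE (weighted_altsum_3mp2 q_nonroot q_neq0).
  have := main _ W; rewrite mulrA [a%:R * _]mulrC; apply.
  by apply: laurentM; [apply: laurent_sign | apply: laurent_q].
Qed.
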